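(* Let $(\Omega,\mathcal{F})$ be a measurable space, let $X$ be a finite dimensional Banach space with $B_2$ separable, and let $T:\Omega\times B_2\to E(X,B_1)$ be a random operator which satisfies condition $\mathcal{M}$. Suppose that, for each $\omega\in\Omega$, $T(\omega,\cdot)$ is almost lower semicontinuous, 1-set-contractive, with nonempty values, and that the inverse $(T(\omega,\cdot))^{-1}$ is closed valued, i.e. $\{x\in B_2: y\in T(\omega,x)\}$ is closed for every $y\in X$. In addition, suppose that for each $\omega\in\Omega$ and each $x\in\partial B_1$ with $x\notin T(\omega,x)$, $T(\omega,\cdot)$ satisfies one of the following conditions: (i) for each $y\in T(\omega,x)$, $\|y-z\|<\|y-x\|$ for some $z\in\overline{I_{B_1}(x)}$; (ii) for each $y\in T(\omega,x)$, there exists $\lambda$ with $|\lambda|<1$ such that $\lambda x+(1-\lambda)y\in\overline{I_{B_1}(x)}$; (iii) $T(\omega,x)\subseteq\overline{I_{B_1}(x)}$; (iv) for each $\lambda\in(0,1)$, $x\notin\lambda T(\omega,x)$; (v) for each $y\in T(\omega,x)$, there exists $\gamma\in(1,\infty)$ such that $\|y\|^{\gamma}-1\le\|y-x\|^{\gamma}$; (vi) for each $y\in T(\omega,x)$, there exists $\beta\in(0,1)$ such that $\|y\|^{\beta}-1\ge\|y-x\|^{\beta}$. Then $T$ has a random fixed point.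
   Context: For $R>0$, $B_R=\{x\in X:\|x\|\le R\}$, and $\partial B_1=\{x\in X:\|x\|=1\}$. For $x\in X$, $B(x,r)=\{y\in X:\|y-x\|<r\}$, and $E(X,B_1)=\{B(x,r)\subset X: x\in B_1,\ r\ge 0\}$; so each value $T(\omega,x)$ is a subset of $X$ of the form $B(c,r)$ with $c\in B_1$. For $B_0\subseteq X$, $d(y,B_0)=\inf_{x\in B_0}\|y-x\|$ and $B(B_0,r)=\{y\in X: d(y,B_0)<r\}$. The inward set of $C\subseteq X$ at $x$ is $I_C(x)=\{x+r(y-x): y\in C,\ r\ge 0\}$; the bar denotes closure. $2^{X}$ is the set of nonempty subsets of $X$; for $F:B_2\to 2^{X}$ and $A\subseteq B_2$, $F(A)=\bigcup_{x\in A}F(x)$. Random operator: for each $x\in B_2$, $T(\cdot,x)$ is (lower) measurable, i.e. $\{\omega\in\Omega: T(\omega,x)\cap V\neq\emptyset\}\in\mathcal{F}$ for every open $V\subseteq X$. Almost lower semicontinuous: $F:B_2\to 2^{X}$ is almost lower semicontinuous if for each $x\in B_2$ and each $\varepsilon>0$ there is a neighborhood $U(x)$ of $x$ in $B_2$ such that $\bigcap_{z\in U(x)}B(F(z),\varepsilon)\neq\emptyset$. 1-set-contractive: let $\gamma(\cdot)$ be the Kuratowski measure of noncompactness: for bounded $A\subseteq X$, $\gamma(A)=\inf\{e>0: A$ is covered by a finite number of sets of diameter $\le e\}$, and $\gamma(A)=\infty$ if $A$ is unbounded. $F:B_2\to 2^{X}$ is 1-set-contractive if $\gamma(F(A))\le\gamma(A)$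 for each $A\subseteq B_2$ with $\gamma(A)>0$. (In condition (v), $\gamma$ is just a real number.) Random fixed point of $T$: a measurable mapping $\xi:\Omega\to B_2$ with $\xi(\omega)\in T(\omega,\xi(\omega))$ for every $\omega\in\Omega$. Condition $\mathcal{M}$ for $T$ (with domain set $C=B_2$): whenever $\eta_n,\xi_n:\Omega\to C$ ($n\in\mathbb{N}$) are measurable mappings with $\eta_n(\omega)\in T(\omega,\xi_n(\omega))$ for each $n$ and each $\omega\in\Omega$, and $\xi_n(\omega)-\eta_n(\omega)\to 0$ as $n\to\infty$ for each $\omega\in\Omega$, then there exists a random fixed point $\xi$ of $T$. *)

(* Defs.v *)
From mathcomp Require Import all_boot all_order all_algebra.
From mathcomp Require Import all_classical all_reals all_analysis.

Set Implicit Arguments.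
Unset Strict Implicit.
Unset Printing Implicit Defensive.

Import Order.TTheory GRing.Theory Num.Theory.
Import numFieldNormedType.Exports.

Local Open Scope classical_set_scope.
Local Open Scope ring_scope.

(* A map defined on a subset C of X is represented by a total function on X;
   every predicate below only looks at its values on C. *)

Section NormedSpace.
Context {R : realType} {X : normedModType R}.
Implicit Types (A B C : set X) (F : X -> set X) (x y z : X).

Definition finite_dimensional (V : normedModType R) : Prop :=
  exists (n : nat) (b : 'I_n -> V),
    forall v : V, exists c : 'I_n -> R, v = \sum_(i < n) c i *: b i.

Definition separable_set A : Prop :=
  exists D : set X, [/\ countable D, D `<=` A & A `<=` closure D].

Definition cball (r : R) : set X := [set x | `|x| <= r].

Definition unit_sphere : set X := [set x | `|x| = 1].

(* [ball c 0] is empty, so the empty set belongs to this family. *)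
Definition balls_centered_in C : set (set X) :=
  [set S | exists c r, [/\ C c, 0 <= r & S = ball c r]].

(* Extended-real valued, so that the distance to the empty set is +oo. *)
Definition dist_to y B : \bar R := ereal_inf [set (`|y - x|)%:E | x in B].

Definition enlarge B (r : R) : set X := [set y | (dist_to y B < r%:E)%E].

Definition inward C x : set X :=
  [set z | exists y r, [/\ C y, 0 <= r & z = x + r *: (y - x)]].

(* The maximum with 0 makes the diameter of the empty set 0 and not -oo. *)
Definition diam A : \bar R :=
  maxe 0%E (ereal_sup [set (`|p.1 - p.2|)%:E | p in A `*` A]).

Definition kuratowski A : \bar R :=
  if `[< bounded_set A >] then
    ereal_inf [set e%:E | e in [set e : R | 0 < e /\
      exists (n : nat) (S : 'I_n -> set X),
        (forall i, (diam (S i) <= e%:E)%E) /\ A `<=` \bigcup_i S i]]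
  else +oo%E.

Definition almost_lower_semicontinuous C F : Prop :=
  forall x, C x -> forall eps : R, 0 < eps ->
    exists U : set X, [/\ U `<=` C, within C (nbhs x) U &
      \bigcap_(z in U) enlarge (F z) eps !=set0].

Definition one_set_contractive C F : Prop :=
  forall A, A `<=` C -> (0 < kuratowski A)%E ->
    (kuratowski (\bigcup_(x in A) F x) <= kuratowski A)%E.

Definition inverse_closed_valued C F : Prop :=
  forall y, closed [set x | C x /\ F x y].

Definition cond_i F x : Prop :=
  forall y, F x y ->
    exists z, closure (inward (cball 1) x) z /\ `|y - z| < `|y - x|.

Definition cond_ii F x : Prop :=
  forall y, F x y -> exists lambda : R, `|lambda| < 1 /\
    closure (inward (cball 1) x) (lambda *: x + (1 - lambda) *: y).

Definition cond_iii F x : Prop := F x `<=` closure (inward (cball 1) x).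

Definition cond_iv F x : Prop :=
  forall lambda : R, 0 < lambda -> lambda < 1 ->
    ~ [set lambda *: y | y in F x] x.

Definition cond_v F x : Prop :=
  forall y, F x y ->
    exists gamma : R, 1 < gamma /\ `|y| `^ gamma - 1 <= `|y - x| `^ gamma.

Definition cond_vi F x : Prop :=
  forall y, F x y -> exists beta : R, [/\ 0 < beta, beta < 1 &
    `|y| `^ beta - 1 >= `|y - x| `^ beta].

End NormedSpace.

Section RandomOperators.
Context {R : realType} {X : normedModType R}.
Context {d : measure_display} {Omega : measurableType d}.
Implicit Types (C : set X) (T : Omega -> X -> set X).

(* Measurability is with respect to the Borel sigma-algebra of X; for a map
   with values in C this is measurability for the Borel sigma-algebra of C. *)
Definition measurable_map_into C (xi : Omega -> X) : Prop :=
  measurable_fun setT (xi : Omega -> g_sigma_algebraType (@open X)) /\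
  forall w, C (xi w).

Definition random_operator C T : Prop :=
  forall x, C x -> forall V : set X, open V ->
    measurable [set w | T w x `&` V !=set0].

Definition random_fixed_point C T (xi : Omega -> X) : Prop :=
  measurable_map_into C xi /\ forall w, T w (xi w) (xi w).

Definition condition_M C T : Prop :=
  forall eta xi : nat -> Omega -> X,
    (forall n, measurable_map_into C (eta n)) ->
    (forall n, measurable_map_into C (xi n)) ->
    (forall n w, T w (xi n w) (eta n w)) ->
    (forall w, xi n w - eta n w @[n --> \oo] --> (0 : X)) ->
    exists zeta : Omega -> X, random_fixed_point C T zeta.

End RandomOperators.

(* Main.v *)
(* Condition M reduces the theorem to measurable almost fixed points.

   For a fixed parameter, almost lower semicontinuity and the compactness of
   B_2 give finitely many balls U_k covering B_2 and points p_k with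
   p_k in B(F(z), eps) for all z in U_k. Since the values of F are balls
   centered in B_1, radial retraction lets us take p_k in B_2. The
   combinatorial core of Brouwer's theorem (Scarf's lemma on a grid of the
   simplex) yields a convex combination x of some of the p_k that lies close
   to all the corresponding U_k; convexity of B(F(z), eps) makes every point
   near x almost fixed. Hence almost fixed points occur in a countable dense
   set, and taking the first good pair (x_i, y_j) of points of that set is
   measurable: because F(x_i) is a ball, y_j in F(x_i) can be expressed
   through countably many conditions "F(x_i) meets V" with V open. *)
Require Import Defs.
From mathcomp Require Import all_boot.
From mathcomp Require Import zify.

Set Implicit Arguments.
Unset Strict Implicit.
Unset Printing Implicit Defensive.

(** * Scarf's lemma *)

Section PrimitiveSets.
Context {I V : finType} (r : I -> V -> nat).
Hypothesis r_inj : forall i, injective (r i).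
Implicit Types (P Q : {set V}) (i j k l : I) (x y z v : V).

(** The injective ranks [r i] encode one linear order on [V] per index. For nonempty [P] this is
    Scarf's notion: no point exceeds the [r i]-minimum of [P] for every [i] at once. *)
Definition dominant P := [forall y, exists i, [forall x in P, r i y <= r i x]].

Lemma dominantP P :
  reflect (forall y, exists i, forall x, x \in P -> r i y <= r i x) (dominant P).
Proof.
apply: (iffP forallP) => [h y|h y].
  by have /existsP[i /forall_inP hi] := h y; exists i.
by have [i hi] := h y; apply/existsP; exists i; apply/forall_inP.
Qed.

Lemma dominantS P Q : Q \subset P -> dominant P -> dominant Q.
Proof.
move=> QP /dominantP h; apply/dominantP => y; have [i hi] := h y.
by exists i => x xQ; apply: hi; apply: (subsetP QP).
Qed.

Definition is_low P i x := (x \in P) && [forall y in P, r i x <= r i y].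

Lemma is_lowP P i x :
  reflect (x \in P /\ forall y, y \in P -> r i x <= r i y) (is_low P i x).
Proof. by apply: (iffP andP) => -[? /forall_inP]. Qed.

Lemma is_low_uniq P i x y : is_low P i x -> is_low P i y -> x = y.
Proof.
move=> /is_lowP[xP hx] /is_lowP[yP hy]; apply: (@r_inj i).
by apply/eqP; rewrite eqn_leq hx // hy.
Qed.

Lemma exists_low P : P != set0 -> exists f : I -> V, forall i, is_low P i (f i).
Proof.
move=> /set0Pn[x0 x0P].
exists (fun i => [arg min_(x < x0 in P) r i x]) => i.
by case: arg_minnP => // x xP hx; apply/is_lowP; split.
Qed.

(* As [Q] has one element fewer than [I], [low] takes equal values at a single
   pair [i], [j]; a point completing [Q] to a dominant set must become the low
   point of [i] or of [j], hence is the best point above the other low points. *)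
Section Pivot.
Variables (Q : {set V}) (low : I -> V).
Hypotheses (domQ : dominant Q) (lowQ : forall i, is_low Q i (low i)).
Hypothesis cardQ : #|Q|.+1 = #|I|.

Definition above k := [set y | [forall l, (l != k) ==> (r l (low l) < r l y)]].
(** Kept as a set with at most one element, so that completions of [Q] are counted by cardinals. *)
Definition pivot k := [set x in above k | [forall y in above k, r k y <= r k x]].

Lemma aboveP k y :
  reflect (forall l, l != k -> r l (low l) < r l y) (y \in above k).
Proof. by rewrite inE; apply: (iffP forall_inP). Qed.

Lemma low_in k : low k \in Q. Proof. by have /is_lowP[] := lowQ k. Qed.

Lemma low_le k x : x \in Q -> r k (low k) <= r k x.
Proof. by have /is_lowP[_] := lowQ k; apply. Qed.

(** Dominance of [Q] tested at [x] itself gives an index where [x] is lowest. *)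
Lemma low_onto x : x \in Q -> exists i, low i = x.
Proof.
move=> xQ; have /dominantP/(_ x)[i hi] := domQ; exists i.
by apply: is_low_uniq (lowQ i) _; apply/is_lowP.
Qed.

Lemma pivotP k x :
  reflect (x \in above k /\ forall y, y \in above k -> r k y <= r k x)
          (x \in pivot k).
Proof.
by rewrite [x \in pivot k]in_set; apply: (iffP andP) => -[? /forall_inP].
Qed.

Lemma card_pivot k : #|pivot k| = (above k != set0).
Proof.
have [e|/set0Pn[y0 y0a]] := eqVneq (above k) set0.
  apply/eqP; rewrite cards_eq0; apply/eqP/setP => x; rewrite in_set0.
  by apply/negbTE/negP => /pivotP[]; rewrite e in_set0.
apply/eqP/cards1P; exists [arg max_(x > y0 in above k) r k x].
apply/setP => z; rewrite in_set1; case: arg_maxnP => // x xa hx.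
apply/pivotP/eqP => [[za hz]|->//].
by apply: (@r_inj k); apply/eqP; rewrite eqn_leq hz // andbT; exact: hx.
Qed.

Lemma low_collision : exists i j, i != j /\ low i = low j.
Proof.
have /injectivePn[i [j ij e]] : ~~ injectiveb low.
  apply/negP => /injectiveP inj; have := max_card (mem Q).
  have: #|low @: I| <= #|Q|.
    by apply/subset_leq_card/subsetP => _ /imsetP[k _ ->]; exact: low_in.
  by rewrite card_imset // -cardQ ltnn.
by exists i, j.
Qed.

Variables (i j : I).
Hypotheses (ij : i != j) (eij : low i = low j).

(** A point of [Q] is low for some index, which strictness forces to be [k]; but the low point of
    [k] is also that of the other index of the pair. *)
Lemma above_notin k x : (k == i) || (k == j) -> x \in above k -> x \notin Q.
Proof.
move=> kij /aboveP xa; apply/negP => /low_onto[m e].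
have [mk|mk] := eqVneq m k; last by have := xa m mk; rewrite e ltnn.
case/orP: kij => /eqP kE; subst k m.
  by have := xa j; rewrite eq_sym ij -eij e ltnn => /(_ isT).
by have := xa i; rewrite ij eij e ltnn => /(_ isT).
Qed.

(** A common point would strictly exceed every low point of [Q], against dominance. *)
Lemma above_disjoint k l x : k != l -> x \in above k -> x \notin above l.
Proof.
move=> kl /aboveP xk; apply/negP => /aboveP xl.
have /dominantP/(_ x)[m hm] := domQ.
have := hm _ (low_in m); rewrite leqNgt.
by have [->|mk] := eqVneq m k; [rewrite xl|rewrite xk].
Qed.

(** Against a point of [above k] the index [k] works, by maximality of [x] and dominance of [Q]; any
    other point is at most some [low l] with [l != k], which [x] exceeds. *)
Lemma pivot_dominant k x :
  (k == i) || (k == j) -> x \in pivot k -> dominant (x |: Q).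
Proof.
move=> kij /pivotP[xa xmax]; apply/dominantP => y.
have [ya|] := boolP (y \in above k).
  exists k => z; rewrite in_setU1 => /orP[/eqP->|zQ]; first exact: xmax.
  have /dominantP/(_ y)[m hm] := domQ.
  have [<-|mk] := eqVneq m k; first exact: hm.
  by have /aboveP/(_ _ mk) := ya; rewrite ltnNge hm ?low_in.
rewrite inE negb_forall => /existsP[l]; rewrite negb_imply -leqNgt => /andP[lk yl].
exists l => z; rewrite in_setU1 => /orP[/eqP->|zQ].
  by apply: leq_trans yl (ltnW _); have /aboveP := xa; apply.
exact: leq_trans yl (low_le _ zQ).
Qed.

(** The set [x |: Q] has as many points as there are indices, so its low points are in bijection
    with the indices. Only one index [k] has [x] as low point and the others keep theirs; as
    [low i = low j], [k] is [i] or [j]. *)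
Lemma dominant_pivot x :
  x \notin Q -> dominant (x |: Q) -> x \in pivot i :|: pivot j.
Proof.
move=> xQ domP; set P := x |: Q.
have P0 : P != set0 by apply/set0Pn; exists x; rewrite setU11.
have [low' low'P] := exists_low P0.
have low'_onto z : z \in P -> exists m, low' m = z.
  move=> zP; have /dominantP/(_ z)[m hm] := domP; exists m.
  by apply: is_low_uniq (low'P m) _; apply/is_lowP.
have low'_inj : injective low'.
  have e : low' @: [set: I] = P.
    apply/setP => z; apply/imsetP/idP => [[m _ ->]|/low'_onto[m <-]]; last by exists m.
    by have /is_lowP[] := low'P m.
  suff : {in [set: I] &, injective low'} by move=> h a b; apply: h; rewrite inE.
  by apply/imset_injP; rewrite e cardsU1 xQ cardsT -cardQ.
have low'E m : low' m != x -> low' m = low m.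
  move=> mx; have /is_lowP[mP hm] := low'P m.
  have mQ : low' m \in Q by move: mP; rewrite in_setU1 (negbTE mx).
  apply: is_low_uniq (lowQ m); apply/is_lowP; split=> // y yQ.
  by apply: hm; rewrite in_setU1 yQ orbT.
have [k kx] := low'_onto x (setU11 _ _).
have lE l : l != k -> low' l = low l.
  by move=> lk; apply: low'E; rewrite -kx (inj_eq low'_inj).
suff xk : x \in pivot k.
  have : (k == i) || (k == j).
    have [//|ki] := eqVneq k i; have [//|kj] := eqVneq k j.
    have := low'_inj i j; rewrite !lE 1?eq_sym // => /(_ eij) /eqP.
    by rewrite (negbTE ij).
  by rewrite inE => /orP[/eqP<-|/eqP<-]; rewrite xk ?orbT.
apply/pivotP; split.
  apply/aboveP => l lk; rewrite ltn_neqAle -lE //.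
  have /is_lowP[_ ->] := low'P l; rewrite ?setU11 // andbT.
  by rewrite (inj_eq (@r_inj l)) -kx (inj_eq low'_inj).
move=> y /aboveP ya; have /dominantP/(_ y)[m hm] := domP.
have [<-|mk] := eqVneq m k; first by apply: hm; rewrite setU11.
by have := ya m mk; rewrite ltnNge hm // in_setU1 low_in orbT.
Qed.

Lemma card_pivots :
  #|[set x | (x \notin Q) && dominant (x |: Q)]| =
  (above i != set0) + (above j != set0).
Proof.
have -> : [set x | (x \notin Q) && dominant (x |: Q)] = pivot i :|: pivot j.
  apply/setP => x; rewrite [LHS]inE; apply/andP/idP => [[xQ dP]|].
    exact: dominant_pivot.
  rewrite inE => /orP[] xp; have /pivotP[xa _] := xp;
    by split; [apply: above_notin xa | apply: pivot_dominant xp]; rewrite eqxx ?orbT.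
rewrite cardsU !card_pivot.
suff -> : pivot i :&: pivot j = set0 by rewrite cards0 subn0.
apply/setP => x; rewrite in_setI in_set0; apply/negbTE/negP => /andP[].
by move=> /pivotP[xi _] /pivotP[xj _]; move: (above_disjoint ij xi); rewrite xj.
Qed.

End Pivot.

(* Counting incidences between rooms (dominant sets of size [#|I|]) and doors
   (dominant sets of size [#|I| - 1] coloured by all of [I] but [i0]): a room
   has an odd number of doors only if it is fully coloured, and every door
   opens on two rooms, except [S @: ~: [set i0]], which opens on one. *)
Section Parity.
Variables (S : I -> V) (c : V -> I) (t0 : V).
Hypotheses (S_min : forall i v, r i (S i) <= r i v).
Hypothesis S_max : forall i j v, i != j -> v \notin codom S -> r i v < r i (S j).
Hypotheses (cS : forall i, c (S i) = i) (t0S : t0 \notin codom S).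
Hypothesis card_I : 1 < #|I|.
Variable i0 : I.

Definition rooms := [set P | dominant P && (#|P| == #|I|)].
Definition doors := [set Q | [&& dominant Q, #|Q|.+1 == #|I| & c @: Q == ~: [set i0]]].
Definition outer_door := S @: ~: [set i0].

Lemma S_inj : injective S. Proof. exact: can_inj cS. Qed.

(** A slack point [S l] is tested at [l], where it is least; any other point at [i0], where the
    slack points of the other indices lie above it. *)
Lemma outer_door_in : outer_door \in doors.
Proof.
rewrite inE; apply/and3P; split.
- apply/dominantP => y; have [/codomP[l ->]|yS] := boolP (y \in codom S).
    by exists l => x _.
  exists i0 => _ /imsetP[l + ->]; rewrite !inE => li0.
  by apply/ltnW/S_max; rewrite // eq_sym.
- by rewrite card_imset; [rewrite cardsC1 prednK // ltnW|exact: S_inj].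
- by rewrite -imset_comp; apply/eqP; rewrite (eq_imset _ cS) imset_id.
Qed.

(** A door made of slack points only is determined by its colours. *)
Lemma inner_door Q : Q \in doors -> Q != outer_door ->
  exists2 t, t \in Q & t \notin codom S.
Proof.
rewrite inE => /and3P[_ _ /eqP cQ] QE.
have [/exists_inP//|/exists_inPn h] := boolP [exists t in Q, t \notin codom S].
case/eqP: QE; apply/setP => x; apply/idP/imsetP => [xQ|[k + ->]].
  have /negPn/codomP[k xk] := h x xQ; exists k => //.
  by rewrite -cQ; apply/imsetP; exists x; rewrite // xk cS.
rewrite -cQ => /imsetP[y yQ ->]; have /negPn/codomP[k' yk] := h y yQ.
by move: yQ; rewrite yk cS.
Qed.

Lemma rooms_at_door Q : Q \in doors ->
  #|[set P in rooms | Q \subset P]| =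
  #|[set x | (x \notin Q) && dominant (x |: Q)]|.
Proof.
rewrite inE => /and3P[_ /eqP cardQ _].
rewrite -(@card_in_imset _ _ (fun x => x |: Q)); last first.
  move=> x y; rewrite !inE => /andP[xQ _] /andP[yQ _] /setP/(_ x).
  by rewrite !in_setU1 eqxx (negbTE xQ) !orbF => /esym/eqP.
apply: eq_card => P; apply/idP/imsetP.
  rewrite !inE => /andP[/andP[dP /eqP cP] QP].
  have /eqP/cards1P[x xE] : #|P :\: Q| = 1.
    by rewrite cardsD (setIidPr QP) cP -cardQ subSnn.
  have : x \in P :\: Q by rewrite xE inE.
  rewrite inE => /andP[xQ xP].
  suff PE : P = x |: Q by exists x; rewrite // inE xQ -PE.
  apply/setP => y; rewrite in_setU1; have /setP/(_ y) := xE; rewrite !inE.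
  by have [/(subsetP QP)->|] := boolP (y \in Q); rewrite ?orbT ?orbF.
move=> [x]; rewrite inE => /andP[xQ dP ->].
by rewrite !inE dP cardsU1 xQ add1n cardQ eqxx subsetUr.
Qed.

Lemma door_data Q : Q \in doors -> exists low i j,
  [/\ forall k, is_low Q k (low k), i != j, low i = low j &
   #|[set P in rooms | Q \subset P]| =
     (above low i != set0) + (above low j != set0)].
Proof.
move=> Qd; rewrite rooms_at_door //; move: Qd.
rewrite inE => /and3P[dQ /eqP cardQ _].
have Q0 : Q != set0 by rewrite -cards_eq0; apply/eqP => e; move: card_I; rewrite -cardQ e.
have [low lowQ] := exists_low Q0.
have [i [j [ij e]]] := low_collision lowQ cardQ.
by exists low, i, j; split=> //; exact: card_pivots.
Qed.

(** The point [S k] beats a non-slack [t] in [Q], hence the low points, in every order but that of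
    [k]; so both pivots exist. *)
Lemma rooms_at_inner_door Q : Q \in doors -> Q != outer_door ->
  #|[set P in rooms | Q \subset P]| = 2.
Proof.
move=> Qd QE; have [t tQ tS] := inner_door Qd QE.
have [low [i [j [lowQ ij e ->]]]] := door_data Qd.
have h k : above low k != set0.
  apply/set0Pn; exists (S k); apply/aboveP => l lk.
  exact: leq_ltn_trans (low_le lowQ _ tQ) (S_max lk tS).
by rewrite !h.
Qed.

(** For [l != i0] the low point is [S l], so the repeated pair is [i0] and some [m]. The point [t0]
    provides a pivot at [i0]. There is none at [m]: a point exceeding [S m] at [i0] is slack, and
    every slack point fails one of the inequalities. *)
Lemma rooms_at_outer_door : #|[set P in rooms | outer_door \subset P]| = 1.
Proof.
have [low [i [j [lowQ ij e ->]]]] := door_data outer_door_in.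
have lowS l : l != i0 -> low l = S l.
  move=> li0; apply: is_low_uniq (lowQ l) _; apply/is_lowP; split=> //.
  by apply/imsetP; exists l; rewrite // !inE.
have ab0 : above low i0 != set0.
  apply/set0Pn; exists t0; apply/aboveP => l li0; rewrite lowS // ltn_neqAle S_min.
  by rewrite (inj_eq (@r_inj l)) andbT; apply: contraNneq t0S => <-; exact: codom_f.
have ab m : m != i0 -> low i0 = low m -> above low m = set0.
  move=> mi0 e0; apply/setP => y; rewrite in_set0; apply/negbTE/negP => /aboveP ya.
  have := ya i0; rewrite eq_sym mi0 e0 lowS // => /(_ isT) y0.
  have [/codomP[l yl]|yS] := boolP (y \in codom S); last first.
    by have := S_max _ yS; move/(_ i0 m); rewrite eq_sym ltnNge ltnW // => /(_ mi0).
  subst y; have [li|li0] := eqVneq l i0.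
    by move: y0; rewrite li ltnNge S_min.
  have [lm|lm] := eqVneq l m; first by move: y0; rewrite lm ltnn.
  by have := ya l lm; rewrite lowS // ltnn.
have [ii|ii0] := eqVneq i i0.
  by subst i; rewrite ab0 ab ?eqxx // eq_sym.
have [jj|jj0] := eqVneq j i0.
  by subst j; rewrite ab0 ab ?eqxx.
by case/eqP: ij; apply: S_inj; rewrite -!lowS.
Qed.

(** If such a room has a door, it misses exactly the colour [i0] and repeats one colour, at two
    points [x] and [x']; its doors are the two sets obtained by deleting one of them. *)
Lemma doors_of_room P : P \in rooms -> c @: P != setT ->
  ~~ odd #|[set Q in doors | Q \subset P]|.
Proof.
rewrite inE => /andP[dP /eqP cardP] cP.
have [->|/set0Pn[Q]] := eqVneq [set Q in doors | Q \subset P] set0.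
  by rewrite cards0.
rewrite inE => /andP[Qd QP]; move: (Qd); rewrite inE => /and3P[dQ /eqP cardQ /eqP cQ].
have cPE : c @: P = ~: [set i0].
  apply/eqP; rewrite eqEsubset -{2}cQ imsetS // andbT.
  apply: contraNT cP => h; rewrite eqEsubset subsetT /=.
  have i0P : i0 \in c @: P.
    by move: h => /subsetPn[k kP]; rewrite !inE negbK => /eqP <-.
  apply/subsetP => k _; have [->//|ki0] := eqVneq k i0.
  by apply: (subsetP (imsetS c QP)); rewrite cQ !inE.
have c_inj : {in Q &, injective c}.
  by apply/imset_injP; rewrite cQ cardsC1 -cardQ.
have /eqP/cards1P[x xE] : #|P :\: Q| = 1.
  by rewrite cardsD (setIidPr QP) cardP -cardQ subSnn.
have : x \in P :\: Q by rewrite xE inE.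
rewrite inE => /andP[xQ xP].
have PE : P = x |: Q.
  apply/setP => y; rewrite in_setU1; have /setP/(_ y) := xE; rewrite !inE.
  by have [/(subsetP QP)->|] := boolP (y \in Q); rewrite ?orbT ?orbF.
have : c x \in c @: Q by rewrite cQ -cPE imset_f.
move=> /imsetP[x' x'Q cx].
have xx' : x != x' by apply: contraNneq xQ => ->.
have x'P : x' \in P by apply: (subsetP QP).
have colour z : z \in P -> (P :\ z \in doors) = (c @: (P :\ z) == ~: [set i0]).
  move=> zP; rewrite inE (dominantS (subsetDl _ _) dP) /=.
  by have := cardsD1 z P; rewrite zP cardP add1n => <-; rewrite eqxx.
suff -> : [set Q in doors | Q \subset P] = [set P :\ x; P :\ x'].
  rewrite cards2; suff -> : P :\ x != P :\ x' by [].
  by apply/eqP => /setP/(_ x'); rewrite !inE eqxx x'P eq_sym xx'.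
apply/setP => Q'; rewrite in_set2 in_set; apply/andP/idP.
  move=> [Q'd Q'P]; move: (Q'd); rewrite inE => /and3P[_ /eqP cardQ' /eqP cQ'].
  have /eqP/cards1P[z zE] : #|P :\: Q'| = 1.
    by rewrite cardsD (setIidPr Q'P) cardP -cardQ' subSnn.
  have Q'E : Q' = P :\ z by rewrite -zE setDDr setDv set0U (setIidPr Q'P).
  have c_inj' : {in Q' &, injective c}.
    by apply/imset_injP; rewrite cQ' cardsC1 -cardQ'.
  have : (x == z) || (x' == z).
    apply/negPn/negP; rewrite negb_or => /andP[xz x'z]; case/eqP: xx'.
    by apply: c_inj'; rewrite // Q'E !inE ?xz ?x'z.
  by rewrite Q'E; case/orP=> /eqP ->; rewrite eqxx ?orbT.
have xD : P :\ x = Q.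
  apply/setP => y; rewrite PE !inE; have [->|] //= := eqVneq y x.
  by rewrite (negbTE xQ).
case/orP => /eqP ->; rewrite subsetDl; split=> //; first by rewrite xD.
rewrite colour // eqEsubset -{1}cPE imsetS ?subsetDl //=.
apply/subsetP => k; rewrite -cQ => /imsetP[y yQ ->].
have [->|yx'] := eqVneq y x'; apply/imsetP.
  by exists x; rewrite // !inE xx'.
by exists y; rewrite // !inE yx' (subsetP QP).
Qed.

Lemma exists_full_room : exists2 P, P \in rooms & c @: P = setT.
Proof.
have [/exists_inP[P Pr /eqP]|/exists_inPn h] :=
  boolP [exists P in rooms, c @: P == setT]; first by exists P.
have E : \sum_(P in rooms) #|[set Q in doors | Q \subset P]| =
         \sum_(Q in doors) #|[set P in rooms | Q \subset P]|.
  transitivity (\sum_(P in rooms) \sum_(Q in doors | Q \subset P) 1).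
    by apply: eq_bigr => P _; rewrite -sum1_card; apply: eq_bigl => Q; rewrite inE.
  rewrite (exchange_big_dep (mem doors)) /= => [|P Q _ /andP[]//].
  apply: eq_bigr => Q Qd; rewrite -sum1_card; apply: eq_bigl => P.
  by rewrite inE Qd.
have : odd (\sum_(Q in doors) #|[set P in rooms | Q \subset P]|).
  rewrite (bigD1 outer_door) ?outer_door_in //= rooms_at_outer_door oddD /=.
  rewrite (eq_bigr (fun=> 2)) => [|Q /andP[]]; last exact: rooms_at_inner_door.
  by rewrite sum_nat_const oddM andbF.
rewrite -E => o; exfalso; move: o; apply/negP; apply: (big_ind (fun n => ~~ odd n)) => //.
  by move=> m n; rewrite oddD => /negbTE-> /negbTE->.
by move=> P Pr; apply: doors_of_room => //; apply: h.
Qed.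

End Parity.
End PrimitiveSets.

(* Scarf's lemma, in the "No bullying" form of Petri and Voorneveld. *)
Lemma scarf (I T : finType) (r : I -> T -> nat) (c : T -> I) :
  (forall i, injective (r i)) -> 0 < #|T| ->
  exists (A : {set T}) (C : {set I}), c @: A = C /\
    forall y, exists2 i, i \in C & forall x, x \in A -> r i y <= r i x.
Proof.
move=> r_inj /card_gt0P[t0 _].
have [I1|I1] := leqP #|I| 1.
  have i1 i : i = c t0 by apply: (fintype_le1P I1).
  exists [set [arg max_(t > t0) r (c t0) t]], setT; split.
    by rewrite imset_set1; apply/setP => i; rewrite in_set1 inE [LHS]eq_sym (i1 i); apply/eqP/i1.
  by move=> y; exists (c t0) => // x; rewrite inE => /eqP ->; case: arg_maxnP => // z _; apply.
(* Slack elements get rank 0 or at least [M.+2], on either side of the shifted ranks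
   [(r i t).+1]. *)
pose M := \max_(i : I) \max_(t : T) r i t.
(* Slack elements [inl i], least for [i] and above [T] for the other indices,
   record the indices outside [C]. *)
pose r' (i : I) (v : I + T) := match v with
  | inl j => if j == i then 0 else M.+2 + enum_rank j
  | inr t => (r i t).+1 end.
have rM i t : r i t <= M.
  apply: leq_trans (leq_bigmax i); exact: (leq_bigmax (F := r i) t).
have r'_inj i : injective (r' i).
  move=> [j|t] [k|s] //=.
  - have [->|_] := eqVneq j i; have [->|_] := eqVneq k i => // /addnI e.
    by congr inl; apply: enum_rank_inj; apply: val_inj.
  - by have [//|_] := eqVneq j i; have := rM i s; lia.
  - by have [//|_] := eqVneq k i; have := rM i t; lia.
  - by move=> [/r_inj ->].
pose c' (v : I + T) := match v with inl j => j | inr t => c t end.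
have S_min i v : r' i (inl i) <= r' i v by rewrite /= eqxx.
have notS (t : T) : inr t \notin codom (@inl I T) by apply/codomP => -[].
have S_max i j v : i != j -> v \notin codom inl -> r' i v < r' i (inl j).
  move=> ij; case: v => [k|t _] /=; first by rewrite codom_f.
  by rewrite eq_sym (negbTE ij); have := rM i t; lia.
have [P] := exists_full_room r'_inj S_min S_max (fun=> erefl : c' _ = _) (notS t0) I1 (c t0).
rewrite inE => /andP[/dominantP dP /eqP cardP] cP.
have c_inj : {in P &, injective c'} by apply/imset_injP; rewrite cP cardsT cardP.
(* The colouring is injective on the full room, so its ordinary points carry exactly the colours
   whose slack element is absent. *)
exists [set t | inr t \in P], [set i | inl i \notin P]; split.
  apply/setP => i; rewrite inE; apply/imsetP/idP => [[t + ->]|iP].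
    rewrite inE => tP; apply/negP => cP'.
    by have := c_inj _ _ cP' tP erefl.
  have : i \in c' @: P by rewrite cP inE.
  move=> /imsetP[[j|t] vP /= e]; first by rewrite e vP in iP.
  by exists t; rewrite ?inE.
(* The index found by dominance lies in the second set: a slack element [inl i] in the room would
   have rank 0, below [y]. *)
move=> y; have [i hi] := dP (inr y); exists i.
  by rewrite inE; apply/negP => /hi /=; rewrite eqxx.
by move=> x; rewrite inE => /hi.
Qed.

(** Scarf's lemma is applied to the grid points of total [N], ordered by each coordinate. The
    coordinatewise minima [b] over [A] have total at least [N - #|I|], so all grid points above [b]
    are close to one another. *)
Lemma scarf_grid (I : finType) (N : nat) (c : (I -> nat) -> I) : 0 < #|I| ->
  exists2 s : I -> nat, \sum_i s i = N & forall i, s i != 0 ->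
    exists t : I -> nat, [/\ \sum_j t j = N, c t = i &
      \sum_j ((t j - s j) + (s j - t j)) <= 2 * #|I|].
Proof.
move=> /card_gt0P[i1 _].
pose T : finType := {f : {ffun I -> 'I_N.+1} | \sum_i f i == N}.
pose k (t : T) i : nat := val t i.
have ksum t : \sum_i k t i = N by apply/eqP; exact: (valP t).
(* A vector of total at most [N] becomes a grid point when coordinate [i] absorbs the deficit. *)
have fill (g : I -> nat) i : \sum_j g j <= N ->
    exists t : T, forall j, k t j = g j + (j == i) * (N - \sum_j g j).
  move=> gN; pose h j := g j + (j == i) * (N - \sum_j g j).
  have hN : \sum_j h j = N.
    rewrite big_split /= (bigD1 i) //= [X in _ + X](bigD1 i) //= eqxx mul1n.
    rewrite [X in _ + (_ + X)]big1 => [|j /negbTE->]; last by rewrite mul0n.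
    by rewrite addn0 -(bigD1 i (P := xpredT) (F := g)) //= subnKC.
  have hle j : h j < N.+1 by rewrite ltnS -[leqRHS]hN (bigD1 j) //= leq_addr.
  have sN : \sum_j [ffun j => Ordinal (hle j)] j == N.
    by apply/eqP; rewrite -[RHS]hN; apply: eq_bigr => j _; rewrite ffunE.
  by exists (exist (fun f : {ffun I -> 'I_N.+1} => \sum_i f i == N) _ sN) => j; rewrite /k /= ffunE.
(* Ties between equal coordinates are broken by an enumeration of [T]. *)
pose r i t := k t i * #|T| + enum_rank t.
have r_inj i : injective (r i).
  move=> t u; rewrite /r => e; apply: enum_rank_inj; apply: val_inj => /=.
  have := congr1 (modn^~ #|T|) e.
  by rewrite !modnMDl !modn_small.
have r_le i t u : r i t <= r i u -> k t i <= k u i.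
  rewrite /r leqNgt => h; rewrite leqNgt; apply: contra h => h.
  apply: (@leq_trans ((k u i).+1 * #|T|)); first by rewrite mulSn addnC ltn_add2r.
  by apply: leq_trans (leq_addr _ _); rewrite leq_mul2r h orbT.
have le0 : \sum_(j : I) 0 <= N by rewrite big1.
have [t1 _] := fill (fun=> 0) i1 le0.
have T0 : 0 < #|T| by apply/card_gt0P; exists t1.
have [A [C [cA dom]]] := scarf (fun t => c (k t)) r_inj T0.
have [i0 i0C _] := dom t1.
have [u0 u0A _] : exists2 u, u \in A & c (k u) = i0.
  by move: i0C; rewrite -cA => /imsetP[u uA ->]; exists u.
pose m i := [arg min_(u < u0 in A) k u i].
have mP i : m i \in A /\ forall u, u \in A -> k (m i) i <= k u i.
  by rewrite /m; case: arg_minnP.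
(* The value 0 off [C], with the deficit later put at [i0] in [C], keeps the support of the final
   point inside [C]. *)
pose b i := if i \in C then k (m i) i else 0.
have bA u i : u \in A -> b i <= k u i.
  by rewrite /b; case: ifP => // _ uA; apply: (mP i).2.
have bN : \sum_i b i <= N.
  by rewrite -(ksum u0); apply: leq_sum => i _; apply: bA.
(* Otherwise some grid point would exceed [b] in every coordinate, against dominance. *)
have Nb : N <= \sum_i b i + #|I|.
  rewrite leqNgt; apply/negP => lt.
  have bN' : \sum_i (b i).+1 <= N.
    under eq_bigr do rewrite -addn1.
    by rewrite big_split /= sum1_card ltnW.
  have [y yE] := fill _ i1 bN'.
  have [i iC /(_ _ (mP i).1)/r_le] := dom y.
  by rewrite yE /b iC; lia.
have [s sE] := fill _ i0 bN.
exists (k s) => // i si0.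
have iC : i \in C.
  apply: contraR si0 => iC; rewrite sE /b (negbTE iC).
  by have [ii|] := eqVneq i i0; first by rewrite ii i0C in iC.
move: iC; rewrite -cA => /imsetP[t tA ->].
exists (k t); split=> //.
apply: (@leq_trans (\sum_j (k t j - b j) + \sum_j (k s j - b j))).
  rewrite -big_split /=; apply: leq_sum => j _.
  by have := bA t j tA; have := sE j; lia.
rewrite !sumnB => [||j _]; [|by move=> j _; rewrite sE leq_addr|exact: bA].
by rewrite !ksum; lia.
Qed.

From mathcomp Require Import all_order all_algebra finmap.
From mathcomp Require Import all_classical all_reals all_analysis.
From mathcomp Require Import ring lra.

Import Order.TTheory GRing.Theory Num.Theory.
Import numFieldNormedType.Exports.

Local Open Scope classical_set_scope.
Local Open Scope ring_scope.

(** * Almost fixed points *)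

(** Grid points divided by [N] serve as barycentric weights. The bound [2 * #|I|] on grid distances
    becomes at most [D / N], which is below [e] for the chosen [N]. *)
Lemma scarf_convex (R : realType) (X : normedModType R) (I : finType)
    (y : I -> X) (P : X -> I -> Prop) (e : R) : (0 < #|I|)%N -> 0 < e ->
  (forall s : I -> R, (forall i, 0 <= s i) -> \sum_i s i = 1 ->
    exists i, P (\sum_i s i *: y i) i) ->
  exists s : I -> R, [/\ forall i, 0 <= s i, \sum_i s i = 1 &
    forall i, s i != 0 -> exists2 z, P z i & `|z - \sum_i s i *: y i| < e].
Proof.
move=> I0 e0 hP; pose M := \sum_i `|y i|.
pose D : R := (2 * #|I|)%:R * M.
pose N := (Num.truncn (D / e)).+1.
have DN : D / N%:R < e.
  rewrite ltr_pdivrMr ?ltr0n // mulrC -ltr_pdivrMr //.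
  exact: truncnS_gt.
have N0 : (N%:R : R) != 0 by rewrite pnatr_eq0.
pose pt (t : I -> nat) : I -> R := fun i => (t i)%:R / N%:R.
have pt_ge0 t i : 0 <= pt t i by rewrite divr_ge0.
have pt_sum t : (\sum_i t i)%N = N -> \sum_i pt t i = 1.
  by move=> tN; rewrite -mulr_suml -natr_sum tN divff.
(* Vectors of total other than [N] receive an arbitrary colour. *)
have /choice[c cP] (t : I -> nat) : exists i, (\sum_i t i)%N = N ->
    P (\sum_i pt t i *: y i) i.
  have [tN|tN] := eqVneq (\sum_i t i)%N N.
    by have [i hi] := hP _ (pt_ge0 t) (pt_sum t tN); exists i.
  by have /card_gt0P[i _] := I0; exists i => /eqP; rewrite (negbTE tN).
have [s sN hs] := scarf_grid N c I0.
exists (pt s); split=> [//||i si]; first exact: pt_sum.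
have [|t [tN tc dist]] := hs i.
  by apply: contraNneq si => e1; rewrite /pt e1 mul0r.
exists (\sum_i pt t i *: y i); first by rewrite -tc; exact: cP.
apply: le_lt_trans DN; rewrite -sumrB.
apply: le_trans (ler_norm_sum _ _ _) _.
have yM j : `|y j| <= M by rewrite /M (bigD1 j) //= lerDl sumr_ge0.
have step j : `|pt t j *: y j - pt s j *: y j| <=
    ((t j - s j) + (s j - t j))%:R * (M / N%:R).
  rewrite -scalerBl normrZ /pt -mulrBl normrM normfV (@ger0_norm _ N%:R) //.
  rewrite mulrAC mulrA ler_pM2r ?invr_gt0 ?ltr0n //.
  apply: ler_pM => //; rewrite natrD.
  have [st|/ltnW ts] := leqP (s j) (t j).
    rewrite (eqP st) addr0 natrB // ger0_norm ?subr_ge0 ?ler_nat //.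
  by rewrite (eqP ts) add0r natrB // distrC ger0_norm ?subr_ge0 ?ler_nat.
apply: le_trans (ler_sum _ (fun j _ => step j)) _.
rewrite -mulr_suml -natr_sum mulrA ler_pM2r ?invr_gt0 ?ltr0n //.
by rewrite ler_wpM2r ?ler_nat // sumr_ge0.
Qed.

(** * Compactness of closed balls in finite dimension *)

Lemma cball_closed (R : realType) (X : normedModType R) (r : R) :
  closed (cball r : set X).
Proof.
apply: (@closed_comp _ _ (fun x : X => `|x|) [set y : R | y <= r]).
  by move=> x _; exact: norm_continuous.
exact: closed_le.
Qed.

(** A spanning family of minimal size is a basis. Its coordinate map [f] is bounded below on the
    compact unit sphere, so the ball is a closed subset of the image of a compact set of
    coordinates. *)
Lemma findim_cball_compact (R : realType) (X : normedModType R) (r : R) :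
  finite_dimensional X -> compact (cball r : set X).
Proof.
move=> fd.
pose spans n := `[< exists b : 'I_n -> X,
  forall v, exists c : 'I_n -> R, v = \sum_(i < n) c i *: b i >].
have [|n /asboolP[b hb] n_min] := @ex_minnP spans.
  by have [n ?] := fd; exists n; apply/asboolP.
pose f (v : 'rV[R]_n) := \sum_(i < n) v ord0 i *: b i.
have f_cont : continuous f.
  apply: (@continuous_big _ _ _ 0 xpredT (@add_continuous X) 'rV[R]_n) => i _ v.
  exact: cvgZl (@coord_continuous _ _ _ ord0 i v).
have fZ a v : f (a *: v) = a *: f v.
  by rewrite /f scaler_sumr; apply: eq_bigr => i _; rewrite mxE scalerA.
(* A nonzero coefficient would express [b i] through the other vectors, which would then span,
   against minimality of [n]. *)
have f0 v : f v = 0 -> v = 0.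
  move=> fv; apply/rowP => i; rewrite mxE; apply/eqP/negPn/negP => vi.
  have bi : b i = - \sum_(k < n.-1) (v ord0 (lift i k) / v ord0 i) *: b (lift i k).
    move: fv; rewrite /f (bigD1_ord i) //= => /eqP; rewrite addr_eq0 => /eqP e.
    apply: (scalerI vi); rewrite e scalerN scaler_sumr; congr (- _).
    by apply: eq_bigr => k _; rewrite scalerA mulrC divfK.
  have : (n <= n.-1)%N.
    apply: n_min; apply/asboolP; exists (fun k => b (lift i k)) => x.
    have [c ->] := hb x.
    exists (fun k => c (lift i k) - c i * (v ord0 (lift i k) / v ord0 i)).
    rewrite (bigD1_ord i) //= {1}bi scalerN scaler_sumr addrC -sumrB.
    by apply: eq_bigr => k _; rewrite scalerBl scalerA.
  by rewrite leqNgt prednK ?leqnn // (leq_ltn_trans _ (ltn_ord i)).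
have [m m0 hm] : exists2 m, 0 < m & forall v, m * `|v| <= `|f v|.
  pose K := [set v : 'rV[R]_n | `|v| = 1].
  (* An empty sphere leaves only [v = 0], and any [m] works. *)
  have [K0|K0] := pselect (K !=set0); last first.
    exists 1 => // v; have [->|v0] := eqVneq v 0; first by rewrite normr0 mulr0.
    case: K0; exists (`|v|^-1 *: v); rewrite /K /= normrZ normfV normr_id mulVf //.
    by rewrite normr_eq0.
  have Kc : compact K.
    apply: bounded_closed_compact.
      by exists 1; split=> // x x1 v /= ->; exact: ltW.
    apply: (@closed_comp _ _ (fun x : 'rV[R]_n => `|x|) [set y : R | y = 1]).
      by move=> x _; exact: norm_continuous.
    exact: closed_eq.
  have cK : {within K, continuous (fun v => `|f v|)}.
    apply: continuous_subspaceT => v.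
    exact: (continuous_comp (f_cont v) (@norm_continuous _ _ _)).
  have [v0 v0K hv0] := compact_EVT_min K0 Kc cK.
  move: v0K; rewrite inE => v0K.
  exists `|f v0|.
    rewrite normr_gt0; apply/eqP => /f0 e.
    by move: v0K; rewrite /K /= e normr0 => /esym/eqP; rewrite oner_eq0.
  move=> v; have [->|vn0] := eqVneq v 0; first by rewrite normr0 mulr0.
  have nv0 : 0 < `|v| by rewrite normr_gt0.
  have := hv0 (`|v|^-1 *: v).
  rewrite inE fZ normrZ normfV normr_id => h.
  rewrite -ler_pdivlMr // mulrC h // /K /= normrZ normfV normr_id mulVf //.
  by rewrite gt_eqF.
apply: (@subclosed_compact _ _ (f @` [set v | `|v| <= r / m])).
- exact: cball_closed.
- apply: continuous_compact; first by apply: continuous_subspaceT.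
  apply: bounded_closed_compact; last exact: cball_closed.
  by exists (r / m); split=> [|x x1 v /= vr]; [exact: num_real|exact: le_trans vr (ltW x1)].
move=> x xr; have [c xE] := hb x.
have fx : f (\row_i c i) = x by rewrite xE; apply: eq_bigr => i _; rewrite mxE.
exists (\row_i c i) => //=.
by rewrite ler_pdivlMr // mulrC; apply: le_trans (hm _) _; rewrite fx.
Qed.

(** * Almost fixed points of ball-valued maps *)

Lemma in_ball (R : realType) (X : normedModType R) (x y : X) (r : R) :
  ball x r y = (`|x - y| < r) :> Prop.
Proof. by rewrite -ball_normE. Qed.

(* The radial retraction onto [cball 2] stays in every ball centered in
   [cball 1]: if [|y| > 2] then [|y - c| > 1], and the image of [y] is a convex
   combination of [y] and [0]. *)
Lemma radial_retraction (R : realType) (X : normedModType R) (y : X) :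
  exists2 p : X, cball 2 p & forall c r, cball 1 c -> `|y - c| < r -> `|p - c| < r.
Proof.
have [y2|y2] := leP `|y| 2; first by exists y.
have y0 : 0 < `|y| by apply: lt_trans y2.
exists ((2 / `|y|) *: y).
  by rewrite /cball /= normrZ ger0_norm ?divr_ge0 // divfK // gt_eqF.
move=> c r c1; apply: le_lt_trans.
have t0 : 0 <= 2 / `|y| by rewrite divr_ge0.
have t1 : 2 / `|y| <= 1 by rewrite ler_pdivrMr // mul1r ltW.
move: (2 / `|y|) t0 t1 => t t0 t1.
have -> : t *: y - c = t *: (y - c) + (1 - t) *: (- c).
  by rewrite scalerBr scalerN scalerBl scale1r opprB addrA subrK.
apply: le_trans (ler_normD _ _) _.
rewrite !normrZ normrN !ger0_norm ?subr_ge0 //.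
have yc : 1 <= `|y - c|.
  by have := lerB_dist y c; rewrite /cball /= in c1; lra.
have : (1 - t) * `|c| <= (1 - t) * `|y - c|.
  by rewrite ler_wpM2l ?subr_ge0 // (le_trans c1 yc).
lra.
Qed.

Lemma alsc_uniform_center (R : realType) (X : normedModType R) (F : X -> set X)
    (e : R) : 0 < e ->
  (forall x, cball 2 x -> balls_centered_in (cball 1) (F x)) ->
  almost_lower_semicontinuous (cball 2) F ->
  forall x, cball 2 x -> exists p : X, exists2 r : R, 0 < r &
    cball 2 p /\ forall z, cball 2 z -> `|z - x| < 2 * r ->
      forall c s, cball 1 c -> F z = ball c s -> `|p - c| < s + e.
Proof.
move=> e0 Fballs alsc x x2.
have [U [_ /nbhs_ballP[r /= r0 rU] [y hy]]] := alsc x x2 e e0.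
have [p p2 hp] := radial_retraction y.
(* Halving lets balls of radius [r] form the cover while the estimate still holds at twice that
   radius. *)
exists p, (r / 2); first by rewrite divr_gt0.
split=> // z z2; rewrite mulrC divfK // => zx c s c1 FE.
have Uz : U z by apply: rU => //; rewrite in_ball distrC.
have [_ [v + <-]] := ereal_inf_lt (hy z Uz).
rewrite FE in_ball lte_fin => vc yv.
apply: hp => //; rewrite -(subrKA v); apply: le_lt_trans (ler_normD _ _) _.
by rewrite addrC ltrD // distrC.
Qed.

Lemma norm_convex_le (R : realType) (X : normedModType R) (I : finType)
    (s : I -> R) (y : I -> X) (c : X) (r : R) :
  (forall i, 0 <= s i) -> \sum_i s i = 1 ->
  (forall i, s i != 0 -> `|y i - c| <= r) -> `|\sum_i s i *: y i - c| <= r.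
Proof.
move=> s0 s1 h.
rewrite -[c]scale1r -s1 scaler_suml -sumrB -[r]mul1r -s1 mulr_suml.
apply: le_trans (ler_norm_sum _ _ _) (ler_sum _ _) => i _.
rewrite -scalerBr normrZ ger0_norm //.
have [->|si] := eqVneq (s i) 0; first by rewrite !mul0r.
by rewrite ler_wpM2l ?h.
Qed.

Lemma almost_fixed_point (R : realType) (X : normedModType R) (F : X -> set X)
    (D : set X) (e : R) : 0 < e -> finite_dimensional X ->
  D `<=` cball 2 -> cball 2 `<=` closure D ->
  (forall x, cball 2 x -> balls_centered_in (cball 1) (F x)) ->
  almost_lower_semicontinuous (cball 2) F ->
  exists a c r, [/\ D a, cball 1 c, F a = ball c r & `|a - c| < r + e].
Proof.
move=> e0 fd D2 Ddense Fballs alsc.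
have e20 : 0 < e / 2 by rewrite divr_gt0.
have /choice[p hp] x : exists p : X, cball 2 x -> exists2 r : R, 0 < r &
    cball 2 p /\ forall z, cball 2 z -> `|z - x| < 2 * r ->
      forall c s, cball 1 c -> F z = ball c s -> `|p - c| < s + e / 2.
  have [x2|] := pselect (cball 2 x); last by exists 0.
  by have [p hp] := alsc_uniform_center e20 Fballs alsc x2; exists p.
have /choice[r hr] x : exists r : R, cball 2 x -> [/\ 0 < r, cball 2 (p x) &
    forall z, cball 2 z -> `|z - x| < 2 * r ->
      forall c s, cball 1 c -> F z = ball c s -> `|p x - c| < s + e / 2].
  have [x2|] := pselect (cball 2 x); last by exists 0.
  by have [r r0 []] := hp x x2; exists r.
have := @findim_cball_compact R X 2 fd; rewrite compact_cover.
move=> /(_ X (cball 2) (fun x => ball x (r x))) [].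
- by move=> x _; exact: ball_open.
- by move=> x x2; exists x => //; apply: ballxx; have [] := hr x x2.
move=> K K2 Kcover; have Kin (i : K) : cball 2 (val i).
  by have := K2 _ (valP i); rewrite inE.
have K0 : (0 < #|{: K}|)%N.
  have [|x xK _] := Kcover 0; first by rewrite /cball /= normr0.
  by apply/card_gt0P; exists [` xK]%fset.
(* A common lower bound of the finitely many radii; the default 1 only keeps it positive. *)
pose m := \big[Num.min/1]_(i : K) r (val i).
have m0 : 0 < m.
  by apply: lt_bigmin => // i _; have [] := hr _ (Kin i).
have mr (i : K) : m <= r (val i) by exact: (bigmin_le _ i (fun i : K => r (val i))).
have m20 : 0 < m / 2 by rewrite divr_gt0.
have p2 (i : K) : cball 2 (p (val i)) by have [] := hr _ (Kin i).
have conv2 (s : K -> R) : (forall i, 0 <= s i) -> \sum_i s i = 1 ->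
    cball 2 (\sum_i s i *: p (val i)).
  move=> s0 s1; rewrite /cball /= -[X in `|X|]subr0.
  by apply: norm_convex_le => // i _; rewrite subr0; exact: p2.
have [|s [s0 s1 hs]] := @scarf_convex R X K (fun i => p (val i))
    (fun z i => ball (val i) (r (val i)) z) _ K0 m20.
  move=> s s0 s1; have [x xK hx] := Kcover _ (conv2 s s0 s1).
  by exists [` xK]%fset.
set x := \sum_i s i *: p (val i) in hs.
(* Two errors of [m / 2] keep [a] within twice the radius of each relevant centre; the errors of
   [e / 2] come from the points [p] and from replacing [x] by [a]. *)
have d0 : 0 < Num.min (m / 2) (e / 2) by rewrite lt_min m20 e20.
have [a [Da]] := Ddense x (conv2 s s0 s1) _ (nbhsx_ballx x _ d0).
rewrite in_ball lt_min => /andP[xam xae].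
have [c [t [c1 t0 Fa]]] := Fballs a (D2 _ Da).
exists a, c, t; split=> //.
have xc : `|x - c| <= t + e / 2.
  apply: norm_convex_le => // i si; apply: ltW.
  have [_ _ h] := hr _ (Kin i); apply: (h a (D2 _ Da) _ _ _ c1 Fa).
  have [z] := hs i si; rewrite in_ball => zi zx.
  have := mr i; have := ler_distD x a (val i); have := ler_distD z x (val i).
  by rewrite (distrC a x) (distrC x z) (distrC z (val i)); lra.
by have := ler_distD x a c; rewrite (distrC a x); lra.
Qed.

(** Moving [a] towards the centre [c] gives [q] inside the ball, near [a], and with norm below 2
    because [c] has norm at most 1. These conditions are open, so a point [b] of [D] near [q]
    inherits them. *)
Lemma almost_fixed_pair (R : realType) (X : normedModType R) (F : X -> set X)
    (D : set X) (e : R) : 0 < e -> finite_dimensional X ->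
  D `<=` cball 2 -> cball 2 `<=` closure D ->
  (forall x, cball 2 x -> balls_centered_in (cball 1) (F x)) ->
  (forall x, cball 2 x -> F x !=set0) ->
  almost_lower_semicontinuous (cball 2) F ->
  exists a b, [/\ D a, D b, F a b, `|b| < 2 & `|a - b| < e].
Proof.
move=> e0 fd D2 Ddense Fballs F0 alsc.
have [a [c [r [Da c1 Fa ac]]]] := almost_fixed_point e0 fd D2 Ddense Fballs alsc.
have r0 : 0 < r.
  have [y] := F0 a (D2 _ Da); rewrite Fa in_ball.
  exact: le_lt_trans.
have re0 : 0 < r + e by rewrite addr_gt0.
(* This ratio splits a distance below [r + e] into parts below [r] and [e]. *)
have [t [t0 t1 tr te]] : exists t, [/\ 0 < t, t < 1, t = r / (r + e) & 1 - t = e / (r + e)].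
  exists (r / (r + e)); rewrite divr_gt0 // ltr_pdivrMr // mul1r ltrDl e0.
  by split=> //; field; rewrite gt_eqF.
pose q := c + t *: (a - c).
have ac_t u : 0 < u -> u / (r + e) * `|a - c| < u.
  by move=> u0; rewrite mulrAC ltr_pdivrMr // ltr_pM2l.
have qr : `|c - q| < r.
  by rewrite distrC addrAC subrr add0r normrZ gtr0_norm // tr ac_t.
have aq : `|a - q| < e.
  have -> : a - q = (1 - t) *: (a - c) by rewrite scalerBl scale1r opprD addrA.
  by rewrite normrZ gtr0_norm ?subr_gt0 // te ac_t.
have q2 : `|q| < 2.
  have -> : q = t *: a + (1 - t) *: c.
    by rewrite /q scalerBr scalerBl scale1r addrC -addrA [- _ + c]addrC.
  apply: le_lt_trans (ler_normD _ _) _.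
  rewrite !normrZ (gtr0_norm t0) (@gtr0_norm _ (1 - t)) ?subr_gt0 //.
  have : t * `|a| <= t * 2 by rewrite ler_pM2l //; exact: D2.
  have : (1 - t) * `|c| <= (1 - t) * 1 by rewrite ler_pM2l ?subr_gt0.
  lra.
have : nbhs q (ball c r `&` ball a e `&` ball 0 2).
  apply: open_nbhs_nbhs; split; first by apply: openI; [apply: openI|]; exact: ball_open.
  by split; [split|]; rewrite in_ball // sub0r normrN.
move=> /(Ddense q (ltW q2))[b [Db [[]]]].
rewrite !in_ball sub0r normrN => cb ab b2.
by exists a, b; rewrite Fa in_ball.
Qed.

(** * Measurable selection *)

Lemma countable_range (T : Type) (D : set T) : countable D -> D !=set0 ->
  exists e : nat -> T, D = range e.
Proof.
move=> /countable_injP[f finj] [x0 Dx0].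
have /choice[e he] n : exists x, D x /\ forall y, D y -> f y = n -> x = y.
  have [[x [Dx fx]]|h] := pselect (exists x, D x /\ f x = n).
    exists x; split=> // y Dy fy; apply: finj; rewrite ?inE //.
    by rewrite fx fy.
  by exists x0; split=> // y Dy fy; case: h; exists y.
exists e; apply/seteqP; split=> [y Dy|_ [n _ <-]]; last by have [] := he n.
by exists (f y) => //; have [_] := he (f y); apply.
Qed.

(** The least index is chosen, so its level sets are the differences [seqDU G k]. *)
Lemma measurable_first_index (d : measure_display) (Omega : measurableType d)
    (G : nat -> set Omega) : (forall k, measurable (G k)) ->
  (forall w, exists k, G k w) ->
  exists kappa : Omega -> nat, (forall w, G (kappa w) w) /\
    forall A : set nat, measurable (kappa @^-1` A).
Proof.
move=> mG Gcover.
have ex w : exists k, `[< G k w >].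
  by have [k ?] := Gcover w; exists k; apply/asboolP.
pose kappa w := ex_minn (ex w); exists kappa; split.
  by move=> w; rewrite /kappa; case: ex_minnP => k /asboolP.
move=> A; have -> : kappa @^-1` A = \bigcup_(k in A) seqDU G k.
  apply/seteqP; split=> [w Aw|w [k Ak [Gk nG]]].
    exists (kappa w) => //; split.
      by rewrite /kappa; case: ex_minnP => k /asboolP.
    rewrite -bigcup_mkord => -[j /= jk Gj]; move: jk.
    rewrite /kappa; case: ex_minnP => k _ /(_ j).
    by rewrite leqNgt => h jk; move: h; rewrite jk => /(_ (asboolT Gj)).
  suff -> : (kappa @^-1` A) w = A k by [].
  rewrite /preimage /=; congr A; rewrite /kappa; case: ex_minnP => j /asboolP Gj jmin.
  apply/eqP; rewrite eqn_leq jmin ?asboolT //= leqNgt; apply/negP => jk.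
  by apply: nG; rewrite -bigcup_mkord; exists j.
by apply: bigcup_measurable => k _; exact: seqDU_measurable.
Qed.

(* [b] lies in the open ball [T w a] iff a neighborhood of [b] lies in the
   closed ball, which can be tested on a countable dense set. *)
Lemma measurable_ball_mem (R : realType) (X : normedModType R)
    (d : measure_display) (Omega : measurableType d) (T : Omega -> set X)
    (e : nat -> X) (b : X) :
  cball 2 `<=` closure (range e) ->
  (forall w, balls_centered_in (cball 1) (T w)) ->
  (forall w, T w !=set0) ->
  (forall V, open V -> measurable [set w | T w `&` V !=set0]) ->
  `|b| < 2 -> measurable [set w | T w b].
Proof.
move=> dense Tball T0 Tmeas b2.
have -> : [set w | T w b] =
    \bigcup_k \bigcap_(n in [set n | `|b - e n| < k.+1%:R^-1])
      \bigcap_j [set w | T w `&` ball (e n) j.+1%:R^-1 !=set0].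
  apply/seteqP; split=> w /=; have [c [r [c1 r0 Tw]]] := Tball w.
    rewrite Tw in_ball => cb; have [k hk] := ltr_add_invr cb.
    exists k => // n /= bn j _; exists (e n); split; last exact: ballxx.
    by rewrite Tw in_ball; apply: le_lt_trans (ler_distD b _ _) (lt_trans _ hk); rewrite ltrD2l.
  move=> [k _ hk].
  have rpos : 0 < r.
    by have [y] := T0 w; rewrite Tw in_ball; apply: le_lt_trans.
  rewrite Tw in_ball ltNge; apply/negP => rcb.
  set g := `|c - b| in rcb; have g0 : 0 < g by exact: lt_le_trans rcb.
  (* If [b] is outside the open ball, pushing it away from [c] by [mu / 2] leaves the closed ball;
     the bounds on [mu] keep the new point [q] in the tested neighborhood and in [cball 2]. *)
  have [mu [mu0 mu_k mu_b]] : exists mu : R,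
      [/\ 0 < mu, mu <= k.+1%:R^-1 & mu <= 2 - `|b|].
    exists (Num.min k.+1%:R^-1 (2 - `|b|)).
    by rewrite lt_min invr_gt0 ltr0n subr_gt0 !ge_min !lexx orbT.
  pose tau := mu / 2 / g.
  have tau0 : 0 < tau by rewrite !divr_gt0.
  have taug : tau * g = mu / 2 by rewrite /tau divfK // gt_eqF.
  pose q := b + tau *: (b - c).
  have ntau : `|tau *: (b - c)| = mu / 2.
    by rewrite normrZ gtr0_norm // distrC.
  have q2 : `|q| < 2.
    by apply: le_lt_trans (ler_normD _ _) _; rewrite ntau; lra.
  have bq : `|b - q| < k.+1%:R^-1.
    by rewrite opprD addrA subrr add0r normrN ntau; apply: lt_le_trans mu_k; lra.
  have qc : r < `|q - c|.
    have -> : q - c = (1 + tau) *: (b - c) by rewrite scalerDl scale1r addrAC.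
    rewrite normrZ gtr0_norm ?addr_gt0 // distrC -/g mulrDl mul1r taug.
    by apply: le_lt_trans rcb _; rewrite ltrDl divr_gt0.
  have oV : open [set x : X | r < `|x - c|].
    apply: (@open_comp _ _ (fun x : X => `|x - c|) [set y : R | r < y]); last exact: open_gt.
    move=> x _; apply: (@continuous_comp _ _ _ (fun x => x - c) Num.norm).
      by apply: cvgB; [exact: cvg_id|exact: cvg_cst].
    exact: norm_continuous.
  have qV : nbhs q (ball b k.+1%:R^-1 `&` [set x : X | r < `|x - c|]).
    apply: open_nbhs_nbhs; split; first by apply: openI => //; exact: ball_open.
    by split=> //; rewrite in_ball.
  have [_ [[n _ <-] [bn nc]]] := dense q (ltW q2) _ qV.
  rewrite in_ball in bn; move: nc => /= nc.
  (* A ball around [e n] this small misses [T w], contradicting [hk]. *)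
  have [j hj] := ltr_add_invr nc.
  have [t [+]] := hk n bn j I.
  rewrite Tw !in_ball => ct nt.
  have := ler_distD t (e n) c; rewrite (distrC t c).
  by move: _^-1 hj nt => u; lra.
apply: bigcup_measurable => k _; apply: bigcap_measurableType => n _.
by apply: bigcap_measurableType => j _; apply: Tmeas; exact: ball_open.
Qed.

Lemma measurable_map_comp_index (R : realType) (X : normedModType R)
    (d : measure_display) (Omega : measurableType d) (C : set X)
    (kappa : Omega -> nat) (h : nat -> X) :
  (forall A : set nat, measurable (kappa @^-1` A)) -> (forall n, C (h n)) ->
  measurable_map_into C (h \o kappa).
Proof.
move=> mk Ch; split=> [_ A mA|w]; last exact: Ch.
by rewrite setTI comp_preimage; exact: mk.
Qed.

(** * From measurable almost fixed points to a random fixed point *)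

Theorem theorem6 (R : realType) (X : completeNormedModType R)
    (d : measure_display) (Omega : measurableType d)
    (T : Omega -> X -> set X)
    (X_findim : finite_dimensional X)
    (B2_separable : separable_set (cball 2 : set X))
    (T_balls : forall w x, cball 2 x -> balls_centered_in (cball 1) (T w x))
    (T_random : random_operator (cball 2) T)
    (T_M : condition_M (cball 2) T)
    (T_alsc : forall w, almost_lower_semicontinuous (cball 2) (T w))
    (T_contractive : forall w, one_set_contractive (cball 2) (T w))
    (T_nonempty : forall w x, cball 2 x -> T w x !=set0)
    (T_inverse_closed : forall w, inverse_closed_valued (cball 2) (T w))
    (T_boundary : forall w x, unit_sphere x -> ~ T w x x ->
      cond_i (T w) x \/ cond_ii (T w) x \/ cond_iii (T w) x \/
      cond_iv (T w) x \/ cond_v (T w) x \/ cond_vi (T w) x) :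
  exists xi : Omega -> X, random_fixed_point (cball 2) T xi.
Proof.
have [D [Dc D2 Ddense]] := B2_separable.
have D0 : D !=set0.
  have [|x [Dx _]] := Ddense 0 _ setT (@filterT _ _ _).
    by rewrite /cball /= normr0.
  by exists x.
have [e De] := countable_range Dc D0.
have e2 n : cball 2 (e n) by apply: D2; rewrite De; exists n.
(* One natural number codes a pair of indices; numbers that code no pair default to [(0, 0)]. *)
pose fst_pt k := e (odflt (0, 0)%N (choice.unpickle k)).1.
pose snd_pt k := e (odflt (0, 0)%N (choice.unpickle k)).2.
pose G n k := [set w | [/\ T w (fst_pt k) (snd_pt k), `|snd_pt k| < 2 &
  `|fst_pt k - snd_pt k| < n.+1%:R^-1]].
have mG n k : measurable (G n k).
  (* The two norm conditions do not involve [w]: if one fails, [G n k] is empty. *)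
  have [b2|b2] := pselect (`|snd_pt k| < 2); last first.
    rewrite (_ : G n k = set0); first exact: measurable0.
    by apply/seteqP; split=> // w [].
  have [ab|ab] := pselect (`|fst_pt k - snd_pt k| < n.+1%:R^-1); last first.
    rewrite (_ : G n k = set0); first exact: measurable0.
    by apply/seteqP; split=> // w [].
  rewrite (_ : G n k = [set w | T w (fst_pt k) (snd_pt k)]).
    apply: (@measurable_ball_mem R X d Omega (fun w => T w (fst_pt k)) e) => //.
    - by rewrite -De.
    - by move=> w; apply: T_balls; exact: e2.
    - by move=> w; apply: T_nonempty; exact: e2.
    - by apply: T_random; exact: e2.
  by apply/seteqP; split=> [w []|w].
have Gcover n w : exists k, G n k w.
  have n0 : 0 < n.+1%:R^-1 :> R by rewrite invr_gt0 ltr0n.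
  have [a [b [Da Db Fab b2 ab]]] := almost_fixed_pair n0 X_findim D2 Ddense
    (T_balls w) (T_nonempty w) (T_alsc w).
  move: Da Db; rewrite De => -[i _ ei] [j _ ej].
  by exists (choice.pickle (i, j)); rewrite /G /fst_pt /snd_pt /= choice.pickleK /= ei ej.
have /choice[kappa hk] n := measurable_first_index (mG n) (Gcover n).
(* At stage [n], the first good pair for the tolerance [n.+1%:R^-1] defines both maps, so their
   difference tends to 0. *)
apply: (T_M (fun n => snd_pt \o kappa n) (fun n => fst_pt \o kappa n)).
- by move=> n; apply: measurable_map_comp_index => [|k]; [have [] := hk n|exact: e2].
- by move=> n; apply: measurable_map_comp_index => [|k]; [have [] := hk n|exact: e2].
- by move=> n w; have [/(_ w)[]] := hk n.
move=> w; apply/cvgr0Pnorm_lt => eps eps0.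
near=> n; have [/(_ w)[_ _ h] _] := hk n.
apply: lt_trans h _; near: n.
exact: (near_infty_natSinv_lt (PosNum eps0)).
Unshelve. all: by end_near.
Qed.
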